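(* (Rogosinski inequality) Let $f(q)=\sum_{k=1}^{\infty}q^{k}a_k$ and $g(q)=\sum_{k=1}^{\infty}q^{k}b_k$ be slice regular on $B(0;1)$, with $a_k,b_k\in\mathbb{H}$. If $f\prec_{\mathcal{N}}g$, then $$\sum_{k=1}^{n}\|a_k\|^2\le\sum_{k=1}^{n}\|b_k\|^2\quad\text{for all } n=1,2,\dots$$
   Context: $\mathbb{H}$ is the skew field of quaternions with Euclidean norm $\|\cdot\|$, $B(0;1)=\{q\in\mathbb{H}:\|q\|<1\}$, $\mathbb{S}$ is the sphere of purely imaginary quaternions of norm $1$, and $\mathbb{C}_I=\mathbb{R}+I\mathbb{R}$ for $I\in\mathbb{S}$. A real differentiable function $f:B(0;1)\to\mathbb{H}$ is (left) slice regular, $f\in\mathcal{R}(B(0;1))$, if for every $I\in\mathbb{S}$ one has $\frac12\left(\frac{\partial}{\partial x}+I\frac{\partial}{\partial y}\right)f(x+Iy)=0$ on $B(0;1)\cap\mathbb{C}_I$; equivalently, $f$ is the sum of a convergent power series $\sum_{n\ge0}q^na_n$ on $B(0;1)$. $\mathcal{N}(B(0;1))$ is the set of slice regular $f$ on $B(0;1)$ with $f(B(0;1)\cap\mathbb{C}_I)\subseteq\mathbb{C}_I$ for all $I\in\mathbb{S}$ (equivalently, power series with real coefficients). For slice regular $f,g$ on $B(0;1)$, $f\prec_{\mathcal{N}}g$ means that there exists $w\in\mathcal{N}(B(0;1))$ with $w(0)=0$ and $\|w(q)\|<1$ for all $q\in B(0;1)$ such that $f(q)=(g\bullet w)(q)$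 for all $q\in B(0;1)$. Here, for $g(q)=\sum_{n\ge0} q^nc_n$, $(g\bullet w)(q)=\sum_{n\ge0}(w(q))^{*n}c_n$, where $(\cdot)^{*n}$ is the $n$-th power for the product $\left(\sum q^n\alpha_n\right)*\left(\sum q^n\beta_n\right)=\sum_n q^n\sum_{r=0}^n\alpha_r\beta_{n-r}$; since $w\in\mathcal{N}(B(0;1))$, $g\bullet w$ is the usual composition $g\circ w$. *)

(* Defs.v *)
From Stdlib Require Import Reals.
From Coquelicot Require Import Coquelicot.
Open Scope R_scope.

(* [(a, b, c, d)] is a + b i + c j + d k.  The addition, the real scalar
   multiplication and the topology of [quat] are those of Coquelicot's product
   of normed modules over R, whose norm is the Euclidean one. *)
Definition quat : Type := (R * R * R * R)%type.

Canonical quat_UniformSpace : UniformSpace :=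
  UniformSpace.Pack quat
    (UniformSpace.class (NormedModule.UniformSpace R_AbsRing
      (prod_NormedModule R_AbsRing
        (prod_NormedModule R_AbsRing
          (prod_NormedModule R_AbsRing R_NormedModule R_NormedModule)
          R_NormedModule) R_NormedModule))) quat.

Canonical quat_NormedModule : NormedModule R_AbsRing :=
  NormedModule.Pack R_AbsRing quat
    (NormedModule.class R_AbsRing
      (prod_NormedModule R_AbsRing
        (prod_NormedModule R_AbsRing
          (prod_NormedModule R_AbsRing R_NormedModule R_NormedModule)
          R_NormedModule) R_NormedModule)) quat.

Definition qnorm (q : quat) : R :=
  let '(a, b, c, d) := q in sqrt (a ^ 2 + b ^ 2 + c ^ 2 + d ^ 2).

Definition qadd (p q : quat) : quat := plus p q.

Definition qmul (p q : quat) : quat :=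
  let '(a1, b1, c1, d1) := p in
  let '(a2, b2, c2, d2) := q in
  (a1 * a2 - b1 * b2 - c1 * c2 - d1 * d2,
   a1 * b2 + b1 * a2 + c1 * d2 - d1 * c2,
   a1 * c2 - b1 * d2 + c1 * a2 + d1 * b2,
   a1 * d2 + b1 * c2 - c1 * b2 + d1 * a2).

Definition qreal (x : R) : quat := (x, 0, 0, 0).

Fixpoint qpow (q : quat) (n : nat) : quat :=
  match n with
  | O => qreal 1
  | S m => qmul q (qpow q m)
  end.

Definition in_ball (q : quat) : Prop := qnorm q < 1.

Definition im_unit (I : quat) : Prop :=
  (let '(a, _, _, _) := I in a = 0) /\ qnorm I = 1.

Definition slice_pt (I : quat) (x y : R) : quat :=
  qadd (qreal x) (qmul I (qreal y)).

Definition in_slice (I q : quat) : Prop := exists x y : R, q = slice_pt I x y.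

(* Functions on the ball are total functions on [quat] whose values outside
   the ball are irrelevant.  Real differentiability is Frechet
   differentiability over R. *)
Definition slice_regular (f : quat -> quat) : Prop :=
  (forall q, in_ball q ->
     ex_filterdiff (K := R_AbsRing) (U := quat_NormedModule)
       (V := quat_NormedModule) f (locally q)) /\
  (forall I, im_unit I -> forall x y : R, in_ball (slice_pt I x y) ->
     exists fx fy : quat,
       is_derive (K := R_AbsRing) (V := quat_NormedModule)
         (fun t : R => f (slice_pt I t y)) x fx /\
       is_derive (K := R_AbsRing) (V := quat_NormedModule)
         (fun t : R => f (slice_pt I x t)) y fy /\
       scal (/ 2) (qadd fx (qmul I fy)) = qreal 0).

Definition slice_preserving (f : quat -> quat) : Prop :=
  slice_regular f /\
  forall I, im_unit I -> forall q, in_ball q -> in_slice I q -> in_slice I (f q).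

Definition is_qseries (u : nat -> quat) (s : quat) : Prop :=
  is_series (K := R_AbsRing) (V := quat_NormedModule) u s.

Definition has_expansion (f : quat -> quat) (a : nat -> quat) : Prop :=
  forall q, in_ball q -> is_qseries (fun n => qmul (qpow q n) (a n)) (f q).

Definition star (a b : nat -> quat) (n : nat) : quat :=
  sum_n (G := quat_NormedModule) (fun r => qmul (a r) (b (n - r)%nat)) n.

Fixpoint star_pow (a : nat -> quat) (n : nat) : nat -> quat :=
  match n with
  | O => fun m => match m with O => qreal 1 | S _ => qreal 0 end
  | S p => star a (star_pow a p)
  end.

(* [h = g • w] on the ball: the *-product, hence •, is defined through the
   power series expansions of the functions, and [W n] is the *-power of [w]
   of exponent n. *)
Definition is_bullet (g w h : quat -> quat) : Prop :=
  exists (c alpha : nat -> quat) (W : nat -> quat -> quat),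
    has_expansion g c /\ has_expansion w alpha /\
    (forall n, has_expansion (W n) (star_pow alpha n)) /\
    (forall q, in_ball q -> is_qseries (fun n => qmul (W n q) (c n)) (h q)).

Definition subordinate (f g : quat -> quat) : Prop :=
  exists w : quat -> quat,
    slice_preserving w /\ w (qreal 0) = qreal 0 /\
    (forall q, in_ball q -> qnorm (w q) < 1) /\ is_bullet g w f.

(* Main.v *)
(* For a series [w] with real coefficients and [|w| <= 1] on the disc, the truncated
   lower triangular Toeplitz matrix of [w] is an l2-contraction: integrate
   [Re (w Y conj U)] over circles of radius tending to 1.  As [w 0 = 0], peeling
   off the constant term of [g] (Littlewood) makes the truncated matrix of
   [g |-> g o w] a contraction too.  A slice preserving [w] has real coefficients,
   so the quaternionic statement splits into its four real coordinates, each of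
   which is read off the real axis, where • is ordinary composition. *)
Require Import Defs.
From Stdlib Require Import Reals Lra Lia.
From Coquelicot Require Import Coquelicot.
Open Scope R_scope.

(** * Toeplitz contractions *)

(** Complex numbers are kept as pairs of reals: [cos_sum] and [sin_sum] are the real and imaginary
    parts of the polynomial with terms [c k * exp (i k t)]. The contraction is obtained by taking
    for [U] the truncation of the product of [w] and [Y] itself. With [YY], [ZZ] the sums of squares
    for [Y] and [U], the pointwise bound [Re (w Y conj U) <= (|Y|^2 + |U|^2) / 2] integrates to
    [ZZ <= (YY + ZZ) / 2], so no Cauchy-Schwarz inequality for integrals is involved. The infinite
    series of [w] is never integrated: a partial sum replaces it, at the price of a uniform tail
    that tends to 0. This asks for absolute convergence, whence the radii below 1. The bound on [w]
    must be used on a full complex disc, because [|w| <= 1] on the real interval alone does not give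
    a contraction (the Chebyshev polynomials are bounded by 1 there); only the composition identity
    may be restricted to the real axis. *)

Definition cos_sum (c : nat -> R) (n : nat) (t : R) : R :=
  sum_f_R0 (fun k => c k * cos (INR k * t)) n.

Definition sin_sum (c : nat -> R) (n : nat) (t : R) : R :=
  sum_f_R0 (fun k => c k * sin (INR k * t)) n.

(** The real part of [exp (i p)] times the polynomial of [c]; [sin_sum_shift] is the imaginary
    part. *)
Lemma cos_sum_shift (c : nat -> R) (n : nat) (p t : R) :
  sum_f_R0 (fun k => c k * cos (p + INR k * t)) n
  = cos p * cos_sum c n t - sin p * sin_sum c n t.
Proof.
  unfold cos_sum, sin_sum.
  induction n as [|n IH]; rewrite ?tech5, ?IH; simpl sum_f_R0;
    rewrite cos_plus; ring.
Qed.

Lemma sin_sum_shift (c : nat -> R) (n : nat) (p t : R) :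
  sum_f_R0 (fun k => c k * sin (p + INR k * t)) n
  = sin p * cos_sum c n t + cos p * sin_sum c n t.
Proof.
  unfold cos_sum, sin_sum.
  induction n as [|n IH]; rewrite ?tech5, ?IH; simpl sum_f_R0;
    rewrite sin_plus; ring.
Qed.

Lemma sum_f_R0_lin (f g : nat -> R) (a b : R) (n : nat) :
  a * sum_f_R0 f n + b * sum_f_R0 g n = sum_f_R0 (fun k => a * f k + b * g k) n.
Proof. induction n as [|n IH]; simpl; [ring | rewrite <- IH; ring]. Qed.

(* The left-hand side is the real part of [X Y conj U], where [X], [Y], [U] are
   the trigonometric polynomials with coefficients [x], [y], [u]. *)
Lemma trig_triple_product (x y u : nat -> R) (M N K : nat) (t : R) :
  cos_sum x M t * (cos_sum y N t * cos_sum u K t + sin_sum y N t * sin_sum u K t)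
  - sin_sum x M t * (sin_sum y N t * cos_sum u K t - cos_sum y N t * sin_sum u K t)
  = sum_f_R0 (fun m => u m * sum_f_R0 (fun n => x n * sum_f_R0 (fun k => y k *
      cos ((INR n * t - INR m * t) + INR k * t)) N) M) K.
Proof.
  rewrite (sum_eq _ (fun m =>
    (cos_sum x M t * cos_sum y N t - sin_sum x M t * sin_sum y N t)
      * (u m * cos (INR m * t))
    + (sin_sum x M t * cos_sum y N t + cos_sum x M t * sin_sum y N t)
      * (u m * sin (INR m * t)))).
  { rewrite <- sum_f_R0_lin.
    fold (cos_sum u K t) (sin_sum u K t). ring. }
  intros m _.
  rewrite (sum_eq _ (fun n =>
    cos_sum y N t * (x n * cos (- (INR m * t) + INR n * t))
    + - sin_sum y N t * (x n * sin (- (INR m * t) + INR n * t)))).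
  { rewrite <- sum_f_R0_lin, cos_sum_shift, sin_sum_shift, cos_neg, sin_neg. ring. }
  intros n _. rewrite cos_sum_shift.
  replace (INR n * t - INR m * t) with (- (INR m * t) + INR n * t) by ring.
  ring.
Qed.

Lemma is_RInt_sum_f_R0 (c I : nat -> R) (F : nat -> R -> R) (a b : R) (n : nat) :
  (forall k, is_RInt (F k) a b (I k)) ->
  is_RInt (fun t => sum_f_R0 (fun k => c k * F k t) n) a b
    (sum_f_R0 (fun k => c k * I k) n).
Proof.
  intros H. induction n as [|n IH]; simpl.
  - exact (is_RInt_scal (F O) a b (c O) (I O) (H O)).
  - exact (is_RInt_plus _ _ a b _ _ IH
             (is_RInt_scal (F (S n)) a b (c (S n)) (I (S n)) (H (S n)))).
Qed.

(** Orthogonality of the exponentials: the frequency [z = n - m + k] is an integer, and for [z <> 0]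
    the primitive [sin (z t) / z] takes the same value at both ends. *)
Lemma is_RInt_cos_harmonic (n k m : nat) :
  is_RInt (fun t => cos ((INR n * t - INR m * t) + INR k * t)) 0 (2 * PI)
    (if Nat.eqb (n + k) m then 2 * PI else 0).
Proof.
  destruct (Nat.eqb_spec (n + k) m) as [E|E].
  - apply (is_RInt_ext (fun _ => 1)).
    + intros t _. rewrite <- E, plus_INR. symmetry.
      replace (_ + _) with 0 by ring. apply cos_0.
    + replace (2 * PI) with (scal (2 * PI - 0) 1) at 2
        by (unfold scal; simpl; unfold mult; simpl; ring).
      exact (is_RInt_const 0 (2 * PI) 1).
  - set (z := INR n - INR m + INR k).
    assert (Hz : z <> 0).
    { intro Hz. apply E. apply INR_eq. rewrite plus_INR. unfold z in Hz. lra. }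
    assert (Hs : sin (z * (2 * PI)) = 0).
    { rewrite <- (sin_period _ m).
      replace (z * (2 * PI) + 2 * INR m * PI) with (0 + 2 * INR (n + k) * PI)
        by (rewrite plus_INR; unfold z; ring).
      rewrite sin_period. apply sin_0. }
    replace 0 with (minus (sin (z * (2 * PI)) / z) (sin (z * 0) / z)) at 2.
    2: { rewrite Hs, Rmult_0_r, sin_0. unfold minus, plus, opp; simpl. field. exact Hz. }
    apply (is_RInt_derive (V := R_CompleteNormedModule) (fun t => sin (z * t) / z)).
    + intros t _. auto_derive; [exact Logic.I|].
      replace (INR n * t - INR m * t + INR k * t) with (z * t) by (unfold z; ring).
      field. exact Hz.
    + intros t _. apply (ex_derive_continuous (V := R_NormedModule)).
      auto_derive. exact Logic.I.
Qed.

Lemma sum_f_R0_delta (f : nat -> R) (n i : nat) :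
  sum_f_R0 (fun k => f k * (if Nat.eqb i k then 1 else 0)) n
  = if Nat.leb i n then f i else 0.
Proof.
  induction n as [|n IH].
  - simpl. destruct i; simpl; ring.
  - rewrite tech5, IH.
    destruct (Nat.eqb_spec i (S n)) as [->|E].
    + rewrite Nat.leb_refl, (proj2 (Nat.leb_gt (S n) n)) by lia. ring.
    + destruct (Nat.leb_spec i n), (Nat.leb_spec i (S n)); try lia; ring.
Qed.

Lemma sum_f_R0_truncate (f : nat -> R) (m M : nat) : (m <= M)%nat ->
  sum_f_R0 (fun n => if Nat.leb n m then f n else 0) M = sum_f_R0 f m.
Proof.
  induction M as [|M IH]; intros H.
  - replace m with O by lia. reflexivity.
  - rewrite tech5. destruct (Nat.eq_dec m (S M)) as [->|E].
    + rewrite tech5, Nat.leb_refl. f_equal.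
      apply sum_eq. intros i Hi. rewrite (proj2 (Nat.leb_le _ _)); [reflexivity|lia].
    + rewrite IH, (proj2 (Nat.leb_gt _ _)) by lia. ring.
Qed.

(** Only the index triples with [n + k = m] survive integration, which leaves the Cauchy product
    paired with [u]. Since [m <= N <= M], cutting [x] at [M] and [y] at [N] loses none of them. *)
Lemma is_RInt_trig_triple (x y u : nat -> R) (M N : nat) : (N <= M)%nat ->
  is_RInt (fun t =>
    cos_sum x M t * (cos_sum y N t * cos_sum u N t + sin_sum y N t * sin_sum u N t)
    - sin_sum x M t * (sin_sum y N t * cos_sum u N t - cos_sum y N t * sin_sum u N t))
    0 (2 * PI) (2 * PI * sum_f_R0 (fun m => u m * PS_mult x y m) N).
Proof.
  intros HNM.
  eapply is_RInt_ext.
  { intros t _. symmetry. apply trig_triple_product. }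
  replace (2 * PI * _) with
    (sum_f_R0 (fun m => u m * sum_f_R0 (fun n => x n * sum_f_R0 (fun k => y k *
      (if Nat.eqb (n + k) m then 2 * PI else 0)) N) M) N).
  { apply is_RInt_sum_f_R0 with (F := fun m t => sum_f_R0 (fun n => x n *
      sum_f_R0 (fun k => y k * cos ((INR n * t - INR m * t) + INR k * t)) N) M).
    intros m.
    apply is_RInt_sum_f_R0 with (F := fun n t =>
      sum_f_R0 (fun k => y k * cos ((INR n * t - INR m * t) + INR k * t)) N).
    intros n.
    apply is_RInt_sum_f_R0 with
      (F := fun k t => cos ((INR n * t - INR m * t) + INR k * t)).
    intros k. apply is_RInt_cos_harmonic. }
  rewrite scal_sum. apply sum_eq. intros m Hm.
  rewrite Rmult_assoc. f_equal.
  (* The Cauchy product stops at [n = m]; it is padded with zeros up to [M] to compare term by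
     term. *)
  unfold PS_mult. rewrite <- (sum_f_R0_truncate _ m M) by lia.
  rewrite (Rmult_comm _ (2 * PI)), scal_sum. apply sum_eq. intros n _.
  destruct (Nat.leb_spec n m) as [L|L].
  - rewrite (sum_eq _ (fun k => y k * (if Nat.eqb (m - n) k then 1 else 0) * (2 * PI))).
    + rewrite <- scal_sum, sum_f_R0_delta, (proj2 (Nat.leb_le _ _)) by lia. ring.
    + intros k _.
      destruct (Nat.eqb_spec (n + k) m), (Nat.eqb_spec (m - n) k); try lia; ring.
  - rewrite (sum_eq _ (fun _ => 0)).
    + rewrite sum_eq_R0 by reflexivity. ring.
    + intros k _. destruct (Nat.eqb_spec (n + k) m); [lia|ring].
Qed.

(** The triple integral with [X = 1] and [U = Y]: [x] is the unit for the Cauchy product. *)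
Lemma parseval_trig (y : nat -> R) (N : nat) :
  is_RInt (fun t => cos_sum y N t ^ 2 + sin_sum y N t ^ 2) 0 (2 * PI)
    (2 * PI * sum_f_R0 (fun m => y m ^ 2) N).
Proof.
  set (x := fun k : nat => if Nat.eqb 0 k then 1 else 0).
  assert (Hx : forall (f : nat -> R) M, sum_f_R0 (fun k => x k * f k) M = f O).
  { intros f M. rewrite (sum_eq _ (fun k => f k * (if Nat.eqb 0 k then 1 else 0))).
    - rewrite sum_f_R0_delta. reflexivity.
    - intros k _. unfold x. ring. }
  replace (sum_f_R0 _ N) with (sum_f_R0 (fun m => y m * PS_mult x y m) N).
  - eapply is_RInt_ext; [|exact (is_RInt_trig_triple x y y N N (le_n N))].
    intros t _. cbv beta. unfold cos_sum at 1, sin_sum at 3.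
    rewrite !Hx. simpl INR. rewrite Rmult_0_l, cos_0, sin_0.
    simpl; ring.
  - apply sum_eq. intros m _. unfold PS_mult.
    rewrite (Hx (fun k => y (m - k)%nat)), Nat.sub_0_r. ring.
Qed.

(** The bound does not depend on [e]. With cosines or sines for [e] it is therefore uniform in [t],
    as integration over the circle requires. *)
Lemma Series_tail_bound (x e : nat -> R) (M : nat) :
  ex_series (fun n => Rabs (x n)) -> (forall n, Rabs (e n) <= 1) ->
  Rabs (Series (fun n => x n * e n) - sum_f_R0 (fun n => x n * e n) M)
  <= Series (fun n => Rabs (x n)) - sum_f_R0 (fun n => Rabs (x n)) M.
Proof.
  intros Hx He.
  assert (Hle : forall n, 0 <= Rabs (x n * e n) <= Rabs (x n)).
  { intros n. split; [apply Rabs_pos|]. rewrite Rabs_mult.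
    rewrite <- (Rmult_1_r (Rabs (x n))) at 2.
    apply Rmult_le_compat_l; [apply Rabs_pos | apply He]. }
  assert (Ha : ex_series (fun n => Rabs (x n * e n))).
  { apply (ex_series_le (V := R_CompleteNormedModule)
      (fun n => Rabs (x n * e n)) (fun n => Rabs (x n))); [|exact Hx].
    intros n. unfold norm; simpl. unfold abs; simpl. rewrite Rabs_Rabsolu. apply Hle. }
  rewrite (Series_incr_n (fun n => x n * e n) (S M)) by
    (try lia; apply ex_series_Rabs; exact Ha).
  rewrite (Series_incr_n (fun n => Rabs (x n)) (S M)) by (try lia; exact Hx).
  simpl Init.Nat.pred.
  match goal with |- Rabs (?a + ?b - ?a) <= ?c + ?d - ?c =>
    replace (a + b - a) with b by ring; replace (c + d - c) with d by ring end.
  eapply Rle_trans.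
  - apply Series_Rabs.
    apply (ex_series_incr_n (V := R_NormedModule) (fun n => Rabs (x n * e n)) (S M)).
    exact Ha.
  - apply Series_le.
    + intros n. apply Hle.
    + apply (ex_series_incr_n (V := R_NormedModule) (fun n => Rabs (x n)) (S M)).
      exact Hx.
Qed.

Lemma Rabs_le_of_sq (a b : R) : 0 <= b -> a ^ 2 <= b ^ 2 -> Rabs a <= b.
Proof.
  intros Hb H. rewrite <- (Rabs_pos_eq b) by exact Hb.
  apply Rsqr_le_abs_0. unfold Rsqr. lra.
Qed.

(** Here [P + i Q = Y conj U], so its modulus is the geometric mean of [A] and [B], at most their
    arithmetic mean [h]. Multiplying by [W] of modulus at most 1 keeps the bound, and passing from
    [W] to [X] costs [tau * h] for each of the two coordinates. *)
Lemma triple_product_bound (Xc Xs Wc Ws Yc Ys Uc Us tau : R) :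
  Wc ^ 2 + Ws ^ 2 <= 1 -> Rabs (Wc - Xc) <= tau -> Rabs (Ws - Xs) <= tau ->
  Xc * (Yc * Uc + Ys * Us) - Xs * (Ys * Uc - Yc * Us)
  <= (1 + 2 * tau) * ((Yc ^ 2 + Ys ^ 2) + (Uc ^ 2 + Us ^ 2)) / 2.
Proof.
  intros HW Hc Hs.
  set (P := Yc * Uc + Ys * Us). set (Q := Ys * Uc - Yc * Us).
  set (A := Yc ^ 2 + Ys ^ 2). set (B := Uc ^ 2 + Us ^ 2).
  assert (HA : 0 <= A) by (unfold A; nra).
  assert (HB : 0 <= B) by (unfold B; nra).
  set (h := (A + B) / 2).
  assert (Hh : 0 <= h) by (unfold h; lra).
  assert (HPQ : P ^ 2 + Q ^ 2 <= h ^ 2).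
  { replace (P ^ 2 + Q ^ 2) with (A * B) by (unfold P, Q, A, B; ring).
    pose proof (pow2_ge_0 (A - B)). unfold h. nra. }
  assert (HP : Rabs P <= h)
    by (apply Rabs_le_of_sq; [exact Hh | pose proof (pow2_ge_0 Q); lra]).
  assert (HQ : Rabs Q <= h)
    by (apply Rabs_le_of_sq; [exact Hh | pose proof (pow2_ge_0 P); lra]).
  assert (HWPQ : Rabs (Wc * P - Ws * Q) <= h).
  { apply Rabs_le_of_sq; [exact Hh|].
    apply Rle_trans with ((Wc ^ 2 + Ws ^ 2) * (P ^ 2 + Q ^ 2)).
    (* The square added is that of the imaginary part of [W (P + i Q)]; with the real part it makes
       up the product of the squared moduli. *)
    - pose proof (pow2_ge_0 (Wc * Q + Ws * P)). nra.
    - rewrite <- (Rmult_1_l (h ^ 2)). apply Rmult_le_compat; nra. }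
  assert (H1 : Rabs ((Wc - Xc) * P) <= tau * h)
    by (rewrite Rabs_mult; apply Rmult_le_compat; auto using Rabs_pos).
  assert (H2 : Rabs ((Ws - Xs) * Q) <= tau * h)
    by (rewrite Rabs_mult; apply Rmult_le_compat; auto using Rabs_pos).
  apply Rabs_le_between in H1, H2, HWPQ.
  replace ((1 + 2 * tau) * (A + B) / 2) with ((1 + 2 * tau) * h) by (unfold h; field).
  lra.
Qed.

Lemma toeplitz_contraction_abs (x y : nat -> R) (N : nat) :
  ex_series (fun n => Rabs (x n)) ->
  (forall t, Series (fun n => x n * cos (INR n * t)) ^ 2
           + Series (fun n => x n * sin (INR n * t)) ^ 2 <= 1) ->
  sum_f_R0 (fun m => PS_mult x y m ^ 2) N <= sum_f_R0 (fun m => y m ^ 2) N.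
Proof.
  intros Hx Hw.
  set (u := PS_mult x y).
  set (ZZ := sum_f_R0 (fun m => u m ^ 2) N). set (YY := sum_f_R0 (fun m => y m ^ 2) N).
  set (tau := fun M => Series (fun n => Rabs (x n)) - sum_f_R0 (fun n => Rabs (x n)) M).
  assert (Hpi : 0 < 2 * PI) by (pose proof PI_RGT_0; lra).
  assert (Hstep : forall M, (N <= M)%nat -> ZZ <= (1 + 2 * tau M) * (YY + ZZ) / 2).
  { intros M HM.
    apply (Rmult_le_reg_l (2 * PI)); [exact Hpi|].
    apply (is_RInt_le
      (fun t => cos_sum x M t * (cos_sum y N t * cos_sum u N t + sin_sum y N t * sin_sum u N t)
        - sin_sum x M t * (sin_sum y N t * cos_sum u N t - cos_sum y N t * sin_sum u N t))
      (fun t => (1 + 2 * tau M) / 2 * ((cos_sum y N t ^ 2 + sin_sum y N t ^ 2)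
                          + (cos_sum u N t ^ 2 + sin_sum u N t ^ 2))) 0 (2 * PI)).
    - lra.
    - replace ZZ with (sum_f_R0 (fun m => u m * PS_mult x y m) N).
      + apply is_RInt_trig_triple. exact HM.
      + apply sum_eq. intros i _. fold u. ring.
    - replace (2 * PI * _) with
        ((1 + 2 * tau M) / 2 * (2 * PI * YY + 2 * PI * ZZ)) by field.
      apply (is_RInt_scal (V := R_NormedModule)).
      apply (is_RInt_plus (V := R_NormedModule)); apply parseval_trig.
    - intros t _.
      eapply Rle_trans.
      + apply (triple_product_bound _ _
          (Series (fun n => x n * cos (INR n * t)))
          (Series (fun n => x n * sin (INR n * t)))) with (tau := tau M);
          [exact (Hw t)| |]; apply Series_tail_bound; try exact Hx; intros n.
        * apply Rabs_le, COS_bound.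
        * apply Rabs_le, SIN_bound.
      + apply Req_le. field. }
  assert (Htau : is_lim_seq tau 0).
  { replace (Finite 0) with
      (Rbar_minus (Series (fun n => Rabs (x n))) (Series (fun n => Rabs (x n))))
      by (simpl; f_equal; ring).
    apply is_lim_seq_minus'; [apply is_lim_seq_const|].
    apply (is_lim_seq_ext (sum_n (fun n => Rabs (x n)))).
    - intros n. apply sum_n_Reals.
    - exact (Series_correct _ Hx). }
  (* In the limit [tau = 0] the estimate reads [ZZ <= (YY + ZZ) / 2], which is the claim. The shift
     by [N] keeps the truncation degree at least [N]. *)
  assert (Hlim : Rbar_le ZZ ((1 + 2 * 0) * (YY + ZZ) / 2)).
  { apply (is_lim_seq_le (fun _ => ZZ)
      (fun M => (1 + 2 * tau (M + N)%nat) * (YY + ZZ) / 2)).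
    - intros M. apply Hstep. lia.
    - apply is_lim_seq_const.
    - apply is_lim_seq_mult'; [|apply is_lim_seq_const].
      apply is_lim_seq_mult'; [|apply is_lim_seq_const].
      apply is_lim_seq_plus'; [apply is_lim_seq_const|].
      apply is_lim_seq_mult'; [apply is_lim_seq_const|].
      apply (is_lim_seq_incr_n tau N). exact Htau. }
  simpl in Hlim. lra.
Qed.

(** * Composition of real power series *)

Lemma CV_radius_ge_1 (a : nat -> R) :
  (forall x, Rabs x < 1 -> ex_pseries a x) -> Rbar_le 1 (CV_radius a).
Proof.
  intros H. apply Rbar_not_lt_le. intros Hlt.
  pose proof (CV_radius_ge_0 a) as H0.
  destruct (CV_radius a) as [r| |] eqn:E; simpl in H0, Hlt; try easy.
  assert (Hx : Rabs ((r + 1) / 2) = (r + 1) / 2) by (apply Rabs_pos_eq; lra).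
  apply (CV_disk_outside a ((r + 1) / 2)).
  - rewrite E, Hx. simpl. lra.
  - apply ex_series_lim_0.
    destruct (H ((r + 1) / 2)) as [l Hl]; [rewrite Hx; lra|].
    exists l. apply is_pseries_R, Hl.
Qed.

Lemma CV_radius_inside_1 (a : nat -> R) (x : R) :
  Rbar_le 1 (CV_radius a) -> Rabs x < 1 -> Rbar_lt (Rabs x) (CV_radius a).
Proof. intros H Hx. apply Rbar_lt_le_trans with (Finite 1); assumption. Qed.

Lemma PS_mult_geometric (a b : nat -> R) (r : R) (m : nat) :
  PS_mult (fun n => a n * r ^ n) (fun n => b n * r ^ n) m = PS_mult a b m * r ^ m.
Proof.
  unfold PS_mult. rewrite Rmult_comm, scal_sum. apply sum_eq. intros k Hk.
  replace (r ^ m) with (r ^ k * r ^ (m - k)); [ring|].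
  rewrite <- pow_add. f_equal. lia.
Qed.

Lemma is_lim_seq_sum_f_R0_pow (c : nat -> R) (r : nat -> R) (n : nat) :
  is_lim_seq r 1 ->
  is_lim_seq (fun j => sum_f_R0 (fun m => (c m * r j ^ m) ^ 2) n)
    (sum_f_R0 (fun m => c m ^ 2) n).
Proof.
  intros Hr.
  assert (Hp : forall m, is_lim_seq (fun j => r j ^ m) 1).
  { induction m as [|m IH]; simpl; [apply is_lim_seq_const|].
    rewrite <- (Rmult_1_l 1). apply is_lim_seq_mult'; assumption. }
  assert (Ht : forall m, is_lim_seq (fun j => (c m * r j ^ m) ^ 2) (c m ^ 2)).
  { intros m. apply (is_lim_seq_ext (fun j => c m ^ 2 * (r j ^ m * r j ^ m))).
    - intros j. ring.
    - replace (Finite (c m ^ 2)) with (Finite (c m ^ 2 * (1 * 1))) by (f_equal; ring).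
      apply is_lim_seq_mult'; [apply is_lim_seq_const|].
      apply is_lim_seq_mult'; apply Hp. }
  induction n as [|n IH]; simpl sum_f_R0; [apply Ht|].
  apply is_lim_seq_plus'; [exact IH | apply Ht].
Qed.

Lemma is_lim_seq_one_minus_inv : is_lim_seq (fun j => 1 - / (INR j + 1)) 1.
Proof.
  replace (Finite 1) with (Rbar_minus 1 0) by (simpl; f_equal; ring).
  apply is_lim_seq_minus'; [apply is_lim_seq_const|].
  replace (Finite 0) with (Rbar_inv p_infty) by reflexivity.
  apply is_lim_seq_inv; [|discriminate].
  apply (is_lim_seq_ext (fun j => INR (S j))); [intros; apply S_INR|].
  apply (is_lim_seq_incr_1 INR). exact is_lim_seq_INR.
Qed.

(** The real counterpart of [star_pow]; [star_pow_real] identifies the two when the coefficients are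
    real. *)
Fixpoint cauchy_pow (a : nat -> R) (p : nat) : nat -> R :=
  match p with
  | O => fun m => match m with O => 1 | S _ => 0 end
  | S p => PS_mult a (cauchy_pow a p)
  end.

Lemma PS_mult_sum_r (a c : nat -> R) (P : nat -> nat -> R) (K m : nat) :
  PS_mult a (fun j => sum_f_R0 (fun k => c k * P k j) K) m
  = sum_f_R0 (fun k => c k * PS_mult a (P k) m) K.
Proof.
  induction K as [|K IH]; simpl sum_f_R0.
  - unfold PS_mult. rewrite scal_sum. apply sum_eq. intros; ring.
  - rewrite <- IH. unfold PS_mult. rewrite scal_sum, <- sum_plus.
    apply sum_eq. intros; ring.
Qed.

(* Littlewood's subordination argument on coefficients: peeling off the constant
   term of [c] writes the composition as [c 0 + a * (shifted composition)], two
   orthogonal summands because [a 0 = 0]. *)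
Lemma composition_contraction (a : nat -> R) :
  a O = 0 ->
  (forall y N, sum_f_R0 (fun m => PS_mult a y m ^ 2) N <= sum_f_R0 (fun m => y m ^ 2) N) ->
  forall K c N,
    sum_f_R0 (fun m => sum_f_R0 (fun k => c k * cauchy_pow a k m) K ^ 2) N
    <= sum_f_R0 (fun k => c k ^ 2) K.
Proof.
  intros Ha Hcontr.
  assert (H0 : forall (x : R) N,
    sum_f_R0 (fun m => (x * cauchy_pow a 0 m) ^ 2) N = x ^ 2).
  { intros x N. induction N as [|N IH]; [simpl; ring|].
    rewrite tech5, IH. simpl cauchy_pow. ring. }
  induction K as [|K IH]; intros c N.
  - simpl (sum_f_R0 _ O). rewrite H0. apply Rle_refl.
  - set (X := fun j => sum_f_R0 (fun k => c (S k) * cauchy_pow a k j) K).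
    rewrite (sum_eq _ (fun m => (c O * cauchy_pow a 0 m) ^ 2 + PS_mult a X m ^ 2)).
    + rewrite sum_plus, H0, (decomp_sum (fun k => c k ^ 2)) by lia.
      simpl Init.Nat.pred. apply Rplus_le_compat_l.
      eapply Rle_trans; [apply Hcontr | apply (IH (fun k => c (S k)))].
    + intros m _. rewrite decomp_sum by lia. simpl Init.Nat.pred.
      change (fun i => c (S i) * cauchy_pow a (S i) m)
        with (fun i => c (S i) * PS_mult a (cauchy_pow a i) m).
      rewrite <- (PS_mult_sum_r a (fun k => c (S k))). fold X.
      destruct m as [|m]; simpl cauchy_pow.
      * unfold PS_mult. simpl. rewrite Ha. ring.
      * ring.
Qed.

(** The dilation [a n * r ^ n] converges absolutely for [r < 1] and commutes with the Cauchy
    product, so dilating [y] as well reduces to [toeplitz_contraction_abs]. Only finitely many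
    coefficients are involved, hence [r] may tend to 1 in the finite sums. *)
Lemma toeplitz_contraction (a : nat -> R) :
  Rbar_le 1 (CV_radius a) ->
  (forall r t, 0 <= r < 1 ->
     Series (fun n => a n * r ^ n * cos (INR n * t)) ^ 2
     + Series (fun n => a n * r ^ n * sin (INR n * t)) ^ 2 <= 1) ->
  forall y N, sum_f_R0 (fun m => PS_mult a y m ^ 2) N <= sum_f_R0 (fun m => y m ^ 2) N.
Proof.
  intros Ha Hw y N.
  assert (Hr : forall j, 0 <= 1 - / (INR j + 1) < 1).
  { intros j. pose proof (pos_INR j).
    assert (0 < / (INR j + 1)) by (apply Rinv_0_lt_compat; lra).
    assert (/ (INR j + 1) <= 1)
      by (rewrite <- Rinv_1; apply Rinv_le_contravar; lra).
    lra. }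
  apply (is_lim_seq_le
    (fun j => sum_f_R0 (fun m => (PS_mult a y m * (1 - / (INR j + 1)) ^ m) ^ 2) N)
    (fun j => sum_f_R0 (fun m => (y m * (1 - / (INR j + 1)) ^ m) ^ 2) N)
    (sum_f_R0 (fun m => PS_mult a y m ^ 2) N) (sum_f_R0 (fun m => y m ^ 2) N)).
  - intros j. specialize (Hr j). set (r := 1 - / (INR j + 1)) in *.
    rewrite (sum_eq _ (fun m =>
      PS_mult (fun n => a n * r ^ n) (fun n => y n * r ^ n) m ^ 2))
      by (intros; now rewrite PS_mult_geometric).
    apply (toeplitz_contraction_abs _ (fun n => y n * r ^ n)).
    + apply CV_disk_inside, CV_radius_inside_1; [exact Ha|].
      rewrite Rabs_pos_eq; lra.
    + intros t. apply Hw, Hr.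
  - apply is_lim_seq_sum_f_R0_pow, is_lim_seq_one_minus_inv.
  - apply is_lim_seq_sum_f_R0_pow, is_lim_seq_one_minus_inv.
Qed.

Lemma PSeries_bounded_half (a : nat -> R) :
  Rbar_le 1 (CV_radius a) ->
  exists C, 0 <= C /\ forall x, Rabs x <= / 2 -> Rabs (PSeries a x) <= C.
Proof.
  intros Ha.
  assert (Hs : ex_series (fun n => Rabs (a n * (/ 2) ^ n))).
  { apply CV_disk_inside, CV_radius_inside_1; [exact Ha|].
    rewrite Rabs_pos_eq; lra. }
  assert (Hle : forall x, Rabs x <= / 2 -> forall n,
    0 <= Rabs (a n * x ^ n) <= Rabs (a n * (/ 2) ^ n)).
  { intros x Hx n. split; [apply Rabs_pos|].
    rewrite !Rabs_mult. apply Rmult_le_compat_l; [apply Rabs_pos|].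
    rewrite <- !RPow_abs. apply pow_incr. split; [apply Rabs_pos|].
    rewrite (Rabs_pos_eq (/ 2)) by lra. exact Hx. }
  assert (Hb : forall x, Rabs x <= / 2 ->
    Rabs (PSeries a x) <= Series (fun n => Rabs (a n * (/ 2) ^ n))).
  { intros x Hx. eapply Rle_trans; [apply Series_Rabs | apply Series_le].
    - apply CV_disk_inside, CV_radius_inside_1; [exact Ha | lra].
    - apply Hle, Hx.
    - exact Hs. }
  eexists. split; [|exact Hb].
  eapply Rle_trans; [|apply (Hb 0); rewrite Rabs_R0; lra]. apply Rabs_pos.
Qed.

(** The remainder is [x ^ S n] times the series of shifted coefficients, which has the same radius
    of convergence and so is bounded on the half disc. *)
Lemma PSeries_remainder_bound (a : nat -> R) (n : nat) :
  Rbar_le 1 (CV_radius a) ->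
  exists C, 0 <= C /\ forall x, Rabs x <= / 2 ->
    Rabs (PSeries a x - sum_f_R0 (fun k => a k * x ^ k) n) <= C * Rabs x ^ S n.
Proof.
  intros Ha.
  destruct (PSeries_bounded_half (PS_decr_n a (S n))) as [C [HC Hb]].
  { induction (S n) as [|m IH]; [exact Ha|].
    rewrite (CV_radius_ext _ (PS_decr_1 (PS_decr_n a m))).
    - rewrite CV_radius_decr_1. exact IH.
    - intros k. unfold PS_decr_1, PS_decr_n. f_equal. lia. }
  exists C. split; [exact HC|]. intros x Hx.
  rewrite (PSeries_decr_n a n).
  2: { apply CV_radius_inside, CV_radius_inside_1; [exact Ha | lra]. }
  replace (_ - _) with (x ^ S n * PSeries (PS_decr_n a (S n)) x) by ring.
  rewrite Rabs_mult, <- RPow_abs, Rmult_comm.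
  apply Rmult_le_compat_r; [apply pow_le, Rabs_pos | apply Hb, Hx].
Qed.

(** Letting [x] tend to 0 from the right kills the constant term; then the series is divided by [x]
    and the argument repeats on the shifted coefficients. *)
Lemma PSeries_small_coeff_0 (d : nat -> R) (N : nat) :
  Rbar_le 1 (CV_radius d) ->
  (exists C delta, 0 <= C /\ 0 < delta /\ forall x, 0 < x < delta ->
     Rabs (PSeries d x) <= C * x ^ S N) ->
  forall m, (m <= N)%nat -> d m = 0.
Proof.
  assert (H0 : forall d C delta, Rbar_le 1 (CV_radius d) -> 0 < delta ->
    (forall x, 0 < x < delta -> Rabs (PSeries d x) <= C * x) -> d O = 0).
  { clear. intros d C delta Hd Hdelta H.
    assert (Hc : continuity_pt (PSeries d) 0).
    { apply PSeries_continuity, CV_radius_inside_1; [exact Hd | rewrite Rabs_R0; lra]. }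
    apply continuity_pt_filterlim in Hc.
    (* The 2 keeps [u n] strictly below [delta], also at [n = 0]. *)
    set (u := fun n => delta * / (INR n + 2)).
    assert (Hpos : forall n, 0 < / (INR n + 2) < 1).
    { intros n. pose proof (pos_INR n). split; [apply Rinv_0_lt_compat; lra|].
      rewrite <- Rinv_1. apply Rinv_lt_contravar; lra. }
    assert (Hu : is_lim_seq u 0).
    { replace (Finite 0) with (Finite (delta * 0)) by (f_equal; ring).
      apply is_lim_seq_mult'; [apply is_lim_seq_const|].
      replace (Finite 0) with (Rbar_inv p_infty) by reflexivity.
      apply is_lim_seq_inv; [|discriminate].
      apply (is_lim_seq_ext (fun n => INR (n + 2))); [intros; now rewrite plus_INR|].
      apply (is_lim_seq_incr_n INR 2). exact is_lim_seq_INR. }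
    assert (Hl : is_lim_seq (fun n => Rabs (PSeries d (u n))) (Rabs (d O))).
    { apply (is_lim_seq_abs _ (d O)). rewrite <- (PSeries_0 d).
      exact (filterlim_comp _ _ _ u (PSeries d) _ _ _ Hu Hc). }
    assert (Hle : Rbar_le (Rabs (d O)) (C * 0)).
    { apply (is_lim_seq_le _ (fun n => C * u n) _ _) with (2 := Hl).
      - intros n. apply H. unfold u. specialize (Hpos n). split.
        + apply Rmult_lt_0_compat; lra.
        + rewrite <- (Rmult_1_r delta) at 2. apply Rmult_lt_compat_l; lra.
      - apply is_lim_seq_mult'; [apply is_lim_seq_const | exact Hu]. }
    simpl in Hle. rewrite Rmult_0_r in Hle.
    pose proof (Rabs_pos (d O)). destruct (Req_dec (d O) 0) as [E|E]; [exact E|].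
    apply Rabs_pos_lt in E. lra. }
  revert d. induction N as [|N IH]; intros d Hd [C [delta [HC [Hdelta H]]]] m Hm.
  - replace m with O by lia. apply (H0 d C delta Hd Hdelta).
    intros x Hx. rewrite <- (pow_1 x) at 2. apply H, Hx.
  (* With [x < 1] the higher power is dominated by [x], and the series converges at [x], so that its
     constant term can be split off. *)
  - assert (Hmin : 0 < Rmin delta 1) by (apply Rmin_case; lra).
    assert (Hlt : forall x, 0 < x < Rmin delta 1 -> x < delta /\ x < 1).
    { intros x Hx. pose proof (Rmin_l delta 1). pose proof (Rmin_r delta 1). lra. }
    assert (Hd0 : d O = 0).
    { apply (H0 d C (Rmin delta 1) Hd Hmin). intros x Hx.
      destruct (Hlt x Hx) as [H1 H2].
      eapply Rle_trans; [apply H; lra|].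
      apply Rmult_le_compat_l; [exact HC|].
      change (x ^ S (S N)) with (x * x ^ S N).
      rewrite <- (Rmult_1_r x) at 3. apply Rmult_le_compat_l; [lra|].
      rewrite <- (pow1 (S N)). apply pow_incr. lra. }
    destruct m as [|m]; [exact Hd0|].
    apply (IH (PS_decr_1 d)); [now rewrite CV_radius_decr_1| |lia].
    exists C, (Rmin delta 1). split; [exact HC|]. split; [exact Hmin|]. intros x Hx.
    destruct (Hlt x Hx) as [H1 H2].
    apply (Rmult_le_reg_l x); [lra|].
    replace (x * (C * x ^ S N)) with (C * x ^ S (S N)) by (simpl; ring).
    rewrite <- (Rabs_pos_eq x) at 1 by lra. rewrite <- Rabs_mult.
    replace (x * PSeries (PS_decr_1 d) x) with (PSeries d x).
    + apply H. lra.
    + rewrite PSeries_decr_1, Hd0; [ring|].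
      apply CV_radius_inside, CV_radius_inside_1; [exact Hd|].
      rewrite Rabs_pos_eq; lra.
Qed.

Lemma PSeries_cauchy_pow (a : nat -> R) (k : nat) :
  Rbar_le 1 (CV_radius a) ->
  Rbar_le 1 (CV_radius (cauchy_pow a k)) /\
  forall x, Rabs x < 1 -> PSeries (cauchy_pow a k) x = PSeries a x ^ k.
Proof.
  intros Ha. induction k as [|k [IHr IHv]].
  - assert (H : forall x, is_pseries (cauchy_pow a 0) x 1).
    { intros x. apply is_pseries_R.
      apply (is_series_ext (fun n => cauchy_pow a 0 n)).
      - intros [|n]; simpl; ring.
      - change (is_lim_seq (sum_n (cauchy_pow a 0)) 1).
        apply (is_lim_seq_ext (fun _ => 1)); [|apply is_lim_seq_const].
        intros n. rewrite sum_n_Reals. induction n as [|n IH]; [reflexivity|].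
        rewrite tech5, <- IH. simpl. ring. }
    split.
    + apply CV_radius_ge_1. intros x _. exists 1. apply H.
    + intros x _. apply is_pseries_unique, H.
  - split.
    + apply CV_radius_ge_1. intros x Hx.
      apply ex_pseries_mult; apply CV_radius_inside_1; assumption.
    + intros x Hx. simpl cauchy_pow.
      rewrite PSeries_mult, IHv by (try apply CV_radius_inside_1; assumption).
      reflexivity.
Qed.

Lemma PSeries_sum_cauchy_pow (a c : nat -> R) (K : nat) :
  Rbar_le 1 (CV_radius a) ->
  let s := fun m => sum_f_R0 (fun k => c k * cauchy_pow a k m) K in
  Rbar_le 1 (CV_radius s) /\
  forall x, Rabs x < 1 -> PSeries s x = sum_f_R0 (fun k => c k * PSeries a x ^ k) K.
Proof.
  intros Ha s.
  assert (H : forall x, Rabs x < 1 ->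
    is_pseries s x (sum_f_R0 (fun k => c k * PSeries a x ^ k) K)).
  { intros x Hx. unfold s.
    assert (Hk : forall k, is_pseries (fun m => c k * cauchy_pow a k m) x
                             (c k * PSeries a x ^ k)).
    { intros k. destruct (PSeries_cauchy_pow a k Ha) as [Hr Hv].
      rewrite <- Hv by exact Hx.
      apply (is_pseries_scal (V := R_NormedModule)); [apply Rmult_comm|].
      apply PSeries_correct, CV_radius_inside, CV_radius_inside_1; assumption. }
    induction K as [|K' IH]; simpl sum_f_R0; [apply Hk|].
    apply (is_pseries_plus (V := R_NormedModule)); [exact IH | apply Hk]. }
  split.
  - apply CV_radius_ge_1. intros x Hx. eexists. apply H, Hx.
  - intros x Hx. apply is_pseries_unique, H, Hx.
Qed.

(* [sum_(k <= N) c k w(x)^k] differs from the composition by [O(w(x)^(N+1))], hence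
   by [O(x^(N+1))] as [w(0) = 0]: this yields the coefficients of the composition
   without rearranging a double series. *)
Lemma composition_coefficients (a c d : nat -> R) (N m : nat) :
  Rbar_le 1 (CV_radius a) -> Rbar_le 1 (CV_radius c) -> Rbar_le 1 (CV_radius d) ->
  a O = 0 ->
  (forall x, Rabs x < 1 -> PSeries d x = PSeries c (PSeries a x)) ->
  (m <= N)%nat -> d m = sum_f_R0 (fun k => c k * cauchy_pow a k m) N.
Proof.
  intros Ha Hc Hd Ha0 Hcomp Hm.
  destruct (PSeries_sum_cauchy_pow a c N Ha) as [Hsr Hsv].
  set (s := fun m => sum_f_R0 (fun k => c k * cauchy_pow a k m) N) in *.
  apply Rminus_diag_uniq.
  assert (He : forall x, Rabs x < 1 ->
    is_pseries (PS_minus d s) x (PSeries d x - PSeries s x)).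
  { intros x Hx. apply (is_pseries_minus (V := R_NormedModule));
      apply PSeries_correct, CV_radius_inside, CV_radius_inside_1; assumption. }
  change (PS_minus d s m = 0).
  apply (PSeries_small_coeff_0 _ N); [| |exact Hm].
  { apply CV_radius_ge_1. intros x Hx. eexists. apply He, Hx. }
  destruct (PSeries_remainder_bound a 0 Ha) as [A [HA Hwa]].
  destruct (PSeries_remainder_bound c N Hc) as [B [HB Hwc]].
  (* This threshold forces [A * x <= / 2], so [w(x)] stays where the remainder bound of [c] applies.
     The [+ 1] covers [A = 0] and also gives [x <= / 2]. *)
  exists (B * A ^ S N), (/ (2 * (A + 1))).
  assert (Hinv : 0 < / (2 * (A + 1)) <= / 2).
  { split; [apply Rinv_0_lt_compat | apply Rinv_le_contravar]; lra. }
  split; [|split].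
  - apply Rmult_le_pos; [exact HB | apply pow_le, HA].
  - apply Hinv.
  - intros x Hx.
    assert (Hxa : Rabs x = x) by (apply Rabs_pos_eq; lra).
    rewrite (is_pseries_unique _ _ _ (He x ltac:(rewrite Hxa; lra))).
    rewrite Hcomp, Hsv by (rewrite Hxa; lra).
    assert (Hw : Rabs (PSeries a x) <= A * x).
    { specialize (Hwa x ltac:(rewrite Hxa; lra)).
      simpl in Hwa. rewrite Ha0, Rmult_0_l, Rminus_0_r, Rmult_1_r, Hxa in Hwa.
      exact Hwa. }
    assert (Hw2 : A * x <= / 2).
    { apply Rle_trans with ((A + 1) * / (2 * (A + 1))).
      - apply Rmult_le_compat; lra.
      - apply Req_le. field. lra. }
    eapply Rle_trans; [apply Hwc; lra|].
    rewrite Rmult_assoc. apply Rmult_le_compat_l; [exact HB|].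
    rewrite <- Rpow_mult_distr. apply pow_incr. split; [apply Rabs_pos | exact Hw].
Qed.

(** Cutting the composition at exponent [N] does not change its coefficients up to [N], so the
    contraction is applied with [K = N]. *)
Lemma Rogosinski_real (w a b : nat -> R) :
  Rbar_le 1 (CV_radius w) -> w O = 0 ->
  (forall r t, 0 <= r < 1 ->
     Series (fun n => w n * r ^ n * cos (INR n * t)) ^ 2
     + Series (fun n => w n * r ^ n * sin (INR n * t)) ^ 2 <= 1) ->
  Rbar_le 1 (CV_radius a) -> Rbar_le 1 (CV_radius b) ->
  (forall x, Rabs x < 1 -> PSeries a x = PSeries b (PSeries w x)) ->
  forall N, sum_f_R0 (fun m => a m ^ 2) N <= sum_f_R0 (fun k => b k ^ 2) N.
Proof.
  intros Hw Hw0 Hle Ha Hb Hcomp N.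
  rewrite (sum_eq _ (fun m => sum_f_R0 (fun k => b k * cauchy_pow w k m) N ^ 2)).
  - apply composition_contraction; [exact Hw0|].
    apply toeplitz_contraction; assumption.
  - intros m Hm. f_equal. apply composition_coefficients; assumption.
Qed.

(** * Reduction from quaternionic to real series *)

Lemma is_series_fst {U V : NormedModule R_AbsRing} (u : nat -> U * V) (l : U * V) :
  is_series (V := prod_NormedModule R_AbsRing U V) u l ->
  is_series (fun n => fst (u n)) (fst l).
Proof.
  intros H.
  apply filterlim_ext with
    (fun n => fst (sum_n (G := prod_NormedModule R_AbsRing U V) u n)).
  - induction x as [|n IH]; [now rewrite !sum_O|].
    rewrite !sum_Sn, <- IH. reflexivity.
  - apply filterlim_comp with (1 := H).
    intros P [eps HP]. exists eps. intros y [Hy _]. apply HP, Hy.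
Qed.

Lemma is_series_snd {U V : NormedModule R_AbsRing} (u : nat -> U * V) (l : U * V) :
  is_series (V := prod_NormedModule R_AbsRing U V) u l ->
  is_series (fun n => snd (u n)) (snd l).
Proof.
  intros H.
  apply filterlim_ext with
    (fun n => snd (sum_n (G := prod_NormedModule R_AbsRing U V) u n)).
  - induction x as [|n IH]; [now rewrite !sum_O|].
    rewrite !sum_Sn, <- IH. reflexivity.
  - apply filterlim_comp with (1 := H).
    intros P [eps HP]. exists eps. intros y [_ Hy]. apply HP, Hy.
Qed.

(** Every index from 3 on reads the last coordinate, so that statements may range over all
    [i : nat]. *)
Definition qcoord (i : nat) (q : quat) : R :=
  let '(a, b, c, d) := q in
  match i with 0%nat => a | 1%nat => b | 2%nat => c | _ => d end.

Lemma qcoord_ext (p q : quat) :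
  (forall i, qcoord i p = qcoord i q) -> p = q.
Proof.
  destruct p as [[[p0 p1] p2] p3], q as [[[q0 q1] q2] q3]. intros H.
  pose proof (H 0%nat); pose proof (H 1%nat); pose proof (H 2%nat);
    pose proof (H 3%nat); simpl in *. congruence.
Qed.

Lemma is_qseries_coord (i : nat) (u : nat -> quat) (s : quat) :
  is_qseries u s -> is_series (fun n => qcoord i (u n)) (qcoord i s).
Proof.
  intros H.
  pose proof (is_series_fst (u : nat -> R * R * R * R) s H) as H3.
  pose proof (is_series_snd (u : nat -> R * R * R * R) s H) as Hd.
  pose proof (is_series_fst (fun n => fst (u n)) (fst s) H3) as H2.
  pose proof (is_series_snd (fun n => fst (u n)) (fst s) H3) as Hc.
  pose proof (is_series_fst (fun n => fst (fst (u n))) (fst (fst s)) H2) as Ha.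
  pose proof (is_series_snd (fun n => fst (fst (u n))) (fst (fst s)) H2) as Hb.
  destruct s as [[[sa sb] sc] sd]. simpl in *.
  destruct i as [|[|[|i]]];
    [revert Ha | revert Hb | revert Hc | revert Hd]; apply is_series_ext;
    intros n; destruct (u n) as [[[? ?] ?] ?]; reflexivity.
Qed.

Lemma qcoord_mul_real (i : nat) (x : R) (q : quat) :
  qcoord i (qmul (qreal x) q) = x * qcoord i q.
Proof.
  destruct q as [[[a b] c] d]. unfold qreal; simpl.
  destruct i as [|[|[|i]]]; ring.
Qed.

Lemma qmul_real (x y : R) : qmul (qreal x) (qreal y) = qreal (x * y).
Proof. unfold qmul, qreal. f_equal; [f_equal; [f_equal|]|]; ring. Qed.

Lemma qpow_real (x : R) (n : nat) : qpow (qreal x) n = qreal (x ^ n).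
Proof. induction n as [|n IH]; cbn [qpow]; [|rewrite IH, qmul_real]; reflexivity. Qed.

(** De Moivre's formula in the slice of [i], the copy of the complex plane that carries the circles
    of the Toeplitz bound. *)
Lemma qpow_polar (r t : R) (n : nat) :
  qpow (r * cos t, r * sin t, 0, 0) n
  = (r ^ n * cos (INR n * t), r ^ n * sin (INR n * t), 0, 0).
Proof.
  induction n as [|n IH].
  - simpl. rewrite Rmult_0_l, cos_0, sin_0. unfold qreal. repeat f_equal; ring.
  - cbn [qpow]. rewrite IH, S_INR, Rmult_plus_distr_r, Rmult_1_l, cos_plus, sin_plus.
    unfold qmul. simpl pow. f_equal; [f_equal; [f_equal|]|]; ring.
Qed.

Lemma qnorm_sqr (q : quat) :
  qnorm q ^ 2 = qcoord 0 q ^ 2 + qcoord 1 q ^ 2 + qcoord 2 q ^ 2 + qcoord 3 q ^ 2.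
Proof.
  destruct q as [[[a b] c] d]. unfold qnorm, qcoord. rewrite pow2_sqrt; nra.
Qed.

Lemma in_ball_polar (r t : R) : 0 <= r < 1 -> in_ball (r * cos t, r * sin t, 0, 0).
Proof.
  intros Hr. unfold in_ball, qnorm.
  replace (_ + _ + 0 ^ 2 + 0 ^ 2) with (r ^ 2 * (Rsqr (sin t) + Rsqr (cos t)))
    by (unfold Rsqr; ring).
  rewrite sin2_cos2, Rmult_1_r, sqrt_pow2; lra.
Qed.

Lemma in_ball_real (x : R) : Rabs x < 1 -> in_ball (qreal x).
Proof.
  intros Hx. unfold in_ball, qnorm, qreal.
  replace (_ + _ + 0 ^ 2 + 0 ^ 2) with (Rsqr x) by (unfold Rsqr; ring).
  rewrite sqrt_Rsqr_abs. exact Hx.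
Qed.

(** At a real point the powers are real, and left multiplication by a real number acts on each
    coordinate separately. *)
Lemma has_expansion_coord (f : quat -> quat) (a : nat -> quat) (i : nat) (x : R) :
  has_expansion f a -> Rabs x < 1 ->
  is_pseries (fun n => qcoord i (a n)) x (qcoord i (f (qreal x))).
Proof.
  intros H Hx. apply is_pseries_R.
  generalize (is_qseries_coord i _ _ (H _ (in_ball_real x Hx))).
  apply is_series_ext. intros n. rewrite qpow_real, qcoord_mul_real. apply Rmult_comm.
Qed.

Lemma has_expansion_CV_radius (f : quat -> quat) (a : nat -> quat) (i : nat) :
  has_expansion f a -> Rbar_le 1 (CV_radius (fun n => qcoord i (a n))).
Proof.
  intros H. apply CV_radius_ge_1. intros x Hx. eexists.
  apply has_expansion_coord with (1 := H), Hx.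
Qed.

(** Links the coefficients hidden in the existential of [is_bullet] to the given ones: their
    coordinates are real series with equal sums on the interval. *)
Lemma has_expansion_unique (f : quat -> quat) (a b : nat -> quat) (n : nat) :
  has_expansion f a -> has_expansion f b -> a n = b n.
Proof.
  intros Ha Hb. apply qcoord_ext. intros i.
  apply (PSeries_ext_recip (fun n => qcoord i (a n)) (fun n => qcoord i (b n))).
  - apply Rbar_lt_le_trans with 1; [exact Rlt_0_1|].
    apply has_expansion_CV_radius with (1 := Ha).
  - apply Rbar_lt_le_trans with 1; [exact Rlt_0_1|].
    apply has_expansion_CV_radius with (1 := Hb).
  - exists (mkposreal 1 Rlt_0_1). intros x Hx.
    assert (Hx' : Rabs x < 1).
    { rewrite <- (Rminus_0_r x). exact Hx. }
    rewrite (is_pseries_unique _ _ _ (has_expansion_coord f a i x Ha Hx')).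
    rewrite (is_pseries_unique _ _ _ (has_expansion_coord f b i x Hb Hx')).
    reflexivity.
Qed.

(** The series of the theorem start at exponent 1 and leave [a 0] unconstrained; the value 0 makes
    them expansions in the sense of [has_expansion]. *)
Definition drop_constant (a : nat -> quat) (n : nat) : quat :=
  match n with O => qreal 0 | S _ => a n end.

Lemma has_expansion_drop_constant (f : quat -> quat) (a : nat -> quat) :
  (forall q, in_ball q ->
     is_qseries (fun k => qmul (qpow q (S k)) (a (S k))) (f q)) ->
  has_expansion f (drop_constant a).
Proof.
  intros H q Hq. apply is_series_decr_1.
  replace (plus _ _) with (f q); [apply H, Hq|].
  cbn [qpow drop_constant]. rewrite qmul_real, Rmult_0_r.
  destruct (f q) as [[[? ?] ?] ?]. unfold plus, opp, qreal; simpl.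
  repeat (unfold prod_plus, prod_opp, plus, opp; simpl).
  f_equal; [f_equal; [f_equal|]|]; ring.
Qed.

(** A real point lies in every slice, so its image lies in the slices of both [i] and [j], which
    meet only in the reals. *)
Lemma slice_preserving_real (w : quat -> quat) (x : R) :
  slice_preserving w -> Rabs x < 1 -> exists y, w (qreal x) = qreal y.
Proof.
  intros [_ Hw] Hx.
  assert (Hin : forall I, in_slice I (qreal x)).
  { intros [[[a b] c] d]. exists x, 0. unfold slice_pt, qadd, plus, qreal; simpl.
    repeat (unfold prod_plus, plus; simpl). f_equal; [f_equal; [f_equal|]|]; ring. }
  assert (Hi : im_unit (0, 1, 0, 0)).
  { split; [reflexivity|]. unfold qnorm.
    replace (_ + _ + 0 ^ 2 + 0 ^ 2) with 1 by ring. apply sqrt_1. }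
  assert (Hj : im_unit (0, 0, 1, 0)).
  { split; [reflexivity|]. unfold qnorm.
    replace (_ + _ + 1 ^ 2 + 0 ^ 2) with 1 by ring. apply sqrt_1. }
  destruct (Hw _ Hi _ (in_ball_real x Hx) (Hin _)) as [u [v E]].
  destruct (Hw _ Hj _ (in_ball_real x Hx) (Hin _)) as [u' [v' E']].
  exists u. rewrite E. rewrite E in E'.
  unfold slice_pt, qadd, plus, qreal in *; simpl in *.
  repeat (unfold prod_plus, plus in *; simpl in *).
  injection E' as _ E1 _ _. f_equal; [f_equal; [f_equal|]|]; lra.
Qed.

(** Each imaginary coordinate of [w] is a real power series that vanishes on the real interval. *)
Lemma slice_preserving_coeff_real (w : quat -> quat) (alpha : nat -> quat) (n : nat) :
  slice_preserving w -> has_expansion w alpha ->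
  alpha n = qreal (qcoord 0 (alpha n)).
Proof.
  intros Hw He. apply qcoord_ext. intros i. destruct i as [|i]; [reflexivity|].
  replace (qcoord (S i) (qreal _)) with 0 by (destruct i as [|[|i]]; reflexivity).
  apply (PSeries_small_coeff_0 (fun n => qcoord (S i) (alpha n)) n);
    [apply has_expansion_CV_radius with (1 := He)| |lia].
  exists 0, 1. split; [lra|]. split; [lra|]. intros x Hx.
  assert (Hx' : Rabs x < 1) by (rewrite Rabs_pos_eq; lra).
  rewrite (is_pseries_unique _ _ _ (has_expansion_coord w alpha (S i) x He Hx')).
  destruct (slice_preserving_real w x Hw Hx') as [y ->].
  rewrite Rmult_0_l. apply Req_le.
  destruct i as [|[|i]]; apply Rabs_R0.
Qed.

Lemma sum_n_qreal (x : nat -> R) (n : nat) :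
  sum_n (G := quat_NormedModule) (fun k => qreal (x k)) n = qreal (sum_f_R0 x n).
Proof.
  induction n as [|n IH]; [apply sum_O|].
  rewrite sum_Sn, IH, tech5. unfold qreal, plus; simpl.
  repeat (unfold prod_plus, plus; simpl). f_equal; [f_equal; [f_equal|]|]; ring.
Qed.

Lemma star_real (x y : nat -> R) (a b : nat -> quat) (n : nat) :
  (forall n, a n = qreal (x n)) -> (forall n, b n = qreal (y n)) ->
  star a b n = qreal (PS_mult x y n).
Proof.
  intros Ha Hb. unfold star, PS_mult. rewrite <- sum_n_qreal.
  apply (sum_n_ext (G := quat_NormedModule)). intros k. rewrite Ha, Hb. apply qmul_real.
Qed.

Lemma star_pow_real (x : nat -> R) (a : nat -> quat) (p n : nat) :
  (forall n, a n = qreal (x n)) -> star_pow a p n = qreal (cauchy_pow x p n).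
Proof.
  intros Ha. revert n. induction p as [|p IH]; intros n.
  - destruct n; reflexivity.
  - apply star_real; assumption.
Qed.

Lemma expansion_star_pow_real (w W : quat -> quat) (alpha : nat -> quat)
  (p : nat) (x : R) :
  slice_preserving w -> has_expansion w alpha ->
  has_expansion W (star_pow alpha p) -> Rabs x < 1 ->
  W (qreal x) = qreal (PSeries (fun n => qcoord 0 (alpha n)) x ^ p).
Proof.
  intros Hw He HW Hx. apply qcoord_ext. intros i.
  set (al := fun n => qcoord 0 (alpha n)).
  assert (Hal : forall n, alpha n = qreal (al n))
    by (intros n; apply (slice_preserving_coeff_real w); assumption).
  rewrite <- (is_pseries_unique _ _ _ (has_expansion_coord W _ i x HW Hx)).
  rewrite (PSeries_ext _ (fun n => qcoord i (qreal (cauchy_pow al p n))))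
    by (intros n; now rewrite (star_pow_real al)).
  destruct i as [|i].
  - simpl. apply PSeries_cauchy_pow; [|exact Hx].
    apply has_expansion_CV_radius with (1 := He).
  - destruct i as [|[|i]]; apply PSeries_const_0.
Qed.

(** As the coefficients are real, the two series are the first two coordinates of [w] at the point
    of polar coordinates [r], [t] in the slice of [i]. *)
Lemma unit_bound_polar (w : quat -> quat) (alpha : nat -> quat) (r t : R) :
  slice_preserving w -> has_expansion w alpha ->
  (forall q, in_ball q -> qnorm (w q) < 1) -> 0 <= r < 1 ->
  Series (fun n => qcoord 0 (alpha n) * r ^ n * cos (INR n * t)) ^ 2
  + Series (fun n => qcoord 0 (alpha n) * r ^ n * sin (INR n * t)) ^ 2 <= 1.
Proof.
  intros Hw He Hle Hr.
  set (q := (r * cos t, r * sin t, 0, 0) : quat).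
  assert (Hq : in_ball q) by (apply in_ball_polar, Hr).
  assert (Hn : forall n, qmul (qpow q n) (alpha n) =
    (qcoord 0 (alpha n) * r ^ n * cos (INR n * t),
     qcoord 0 (alpha n) * r ^ n * sin (INR n * t), 0, 0)).
  { intros n. unfold q.
    rewrite qpow_polar, (slice_preserving_coeff_real w alpha n) by assumption.
    unfold qmul, qreal; simpl. f_equal; [f_equal; [f_equal|]|]; ring. }
  assert (Hc : is_series (fun n => qcoord 0 (alpha n) * r ^ n * cos (INR n * t))
                 (qcoord 0 (w q))).
  { generalize (is_qseries_coord 0 _ _ (He q Hq)). apply is_series_ext.
    intros n. now rewrite Hn. }
  assert (Hs : is_series (fun n => qcoord 0 (alpha n) * r ^ n * sin (INR n * t))
                 (qcoord 1 (w q))).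
  { generalize (is_qseries_coord 1 _ _ (He q Hq)). apply is_series_ext.
    intros n. now rewrite Hn. }
  rewrite (is_series_unique _ _ Hc), (is_series_unique _ _ Hs).
  specialize (Hle q Hq).
  assert (H0 : 0 <= qnorm (w q))
    by (destruct (w q) as [[[? ?] ?] ?]; apply sqrt_pos).
  pose proof (qnorm_sqr (w q)).
  pose proof (pow2_ge_0 (qcoord 2 (w q))). pose proof (pow2_ge_0 (qcoord 3 (w q))).
  nra.
Qed.

Lemma sum_qnorm_sqr (a : nat -> quat) (n : nat) :
  sum_n_m (fun k => qnorm (a k) ^ 2) 1 n
  = sum_f_R0 (fun k => qcoord 0 (drop_constant a k) ^ 2) n
  + sum_f_R0 (fun k => qcoord 1 (drop_constant a k) ^ 2) n
  + sum_f_R0 (fun k => qcoord 2 (drop_constant a k) ^ 2) n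
  + sum_f_R0 (fun k => qcoord 3 (drop_constant a k) ^ 2) n.
Proof.
  rewrite <- !sum_plus.
  rewrite (sum_eq _ (fun k => qnorm (drop_constant a k) ^ 2))
    by (intros; now rewrite qnorm_sqr).
  rewrite <- sum_n_Reals. unfold sum_n. rewrite (sum_Sn_m _ 0 n) by lia.
  rewrite (sum_n_m_ext_loc (fun k => qnorm (a k) ^ 2)
             (fun k => qnorm (drop_constant a k) ^ 2)).
  - simpl drop_constant. rewrite qnorm_sqr. unfold plus; simpl. lra.
  - intros [|k] Hk; [lia | reflexivity].
Qed.

Theorem theorem4p13 (f g : quat -> quat) (a b : nat -> quat)
  (hf : slice_regular f) (hg : slice_regular g)
  (hfa : forall q, in_ball q ->
     is_qseries (fun k => qmul (qpow q (S k)) (a (S k))) (f q))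
  (hgb : forall q, in_ball q ->
     is_qseries (fun k => qmul (qpow q (S k)) (b (S k))) (g q))
  (hfg : subordinate f g) :
  forall n : nat, (1 <= n)%nat ->
    sum_n_m (fun k => qnorm (a k) ^ 2) 1 n <= sum_n_m (fun k => qnorm (b k) ^ 2) 1 n.
Proof.
  intros n _.
  apply has_expansion_drop_constant in hfa, hgb.
  destruct hfg as [w [Hw [Hw0 [Hw1 [c [alpha [W [Hc [He [HW Hf]]]]]]]]]].
  set (al := fun m => qcoord 0 (alpha m)).
  assert (Hcoord : forall i,
    sum_f_R0 (fun k => qcoord i (drop_constant a k) ^ 2) n
    <= sum_f_R0 (fun k => qcoord i (drop_constant b k) ^ 2) n).
  { intros i.
    apply (Rogosinski_real al (fun k => qcoord i (drop_constant a k))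
             (fun k => qcoord i (drop_constant b k))).
    - apply has_expansion_CV_radius with (1 := He).
    - assert (E := is_pseries_unique al 0 _
        (has_expansion_coord w alpha 0 0 He ltac:(rewrite Rabs_R0; lra))).
      rewrite PSeries_0, Hw0 in E. exact E.
    - intros r t Hr. apply (unit_bound_polar w); assumption.
    - apply has_expansion_CV_radius with (1 := hfa).
    - apply has_expansion_CV_radius with (1 := hgb).
    (* By definition of [•], coordinate [i] of [f] at [x] sums the terms [w(x) ^ m] times coordinate
       [i] of the coefficients of [g], a real series evaluated at [w(x)]. *)
    - intros x Hx.
      rewrite (is_pseries_unique _ _ _ (has_expansion_coord f _ i x hfa Hx)).
      symmetry. apply is_pseries_unique, is_pseries_R.
      generalize (is_qseries_coord i _ _ (Hf _ (in_ball_real x Hx))).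
      apply is_series_ext. intros m.
      rewrite (expansion_star_pow_real w (W m) alpha m x Hw He (HW m) Hx).
      rewrite qcoord_mul_real, (has_expansion_unique g c _ m Hc hgb).
      apply Rmult_comm. }
  rewrite !sum_qnorm_sqr.
  repeat apply Rplus_le_compat; apply Hcoord.
Qed.
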